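(* Let $n,k\ge 0$ be integers. Call a permutation $\pi$ of $\{1,\ldots,n+k\}$ a Vesztergombi permutation if $-k\le \pi(i)-i\le n$ for all $i$, and let $\mathcal V_n^k$ be the set of such permutations. Define $pB_{n,k}(q)=\sum_{\pi\in\mathcal V_n^k}q^{\mathrm{inv}(\pi)}$, where $\mathrm{inv}(\pi)$ is the number of pairs $i<j$ with $\pi(i)>\pi(j)$. Then $$pB_{n,k}(q)=q^{nk}\sum_{m=0}^{\min(n,k)}S_{n+1,m+1}(1/q)\,S_{k+1,m+1}(1/q)\,\big([m]_q!\big)^2\,q^{m}.$$
   Context: $[n]_q=1+q+\cdots+q^{n-1}$, $[m]_q!=[1]_q\cdots[m]_q$, $[0]_q!=1$. The $q$-Stirling numbers $S_{n,k}(q)$ are defined by $S_{0,0}(q)=1$, $S_{n,k}(q)=0$ if $k<0$ or $k>n$, and $S_{n+1,k}(q)=q^{k-1}S_{n,k-1}(q)+[k]_qS_{n,k}(q)$ for $0\le k\le n+1$ (with $[0]_q=0$). *)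

(* Defs.v *)
From mathcomp Require Import all_boot all_order all_fingroup all_algebra.

Set Implicit Arguments.
Unset Strict Implicit.
Unset Printing Implicit Defensive.

Import GRing.Theory.
Local Open Scope ring_scope.

Section QAnalogues.

Variables (F : fieldType) (q : F).

Definition qint (n : nat) : F := \sum_(i < n) q ^+ i.

Definition qfact (m : nat) : F := \prod_(1 <= i < m.+1) qint i.

(* The second index is a natural number, so the term S_{n,-1} = 0 of the
   recurrence at k = 0 is dropped, leaving [0]_q S_{n,0}. That S_{n,k} = 0 for
   k > n is [qStirling_gt] below. *)
Fixpoint qStirling (n k : nat) : F :=
  match n, k with
  | 0, 0 => 1
  | 0, _.+1 => 0
  | n'.+1, 0 => qint 0 * qStirling n' 0
  | n'.+1, k'.+1 => q ^+ k' * qStirling n' k' + qint k'.+1 * qStirling n' k'.+1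
  end.

Lemma qStirling_gt (n k : nat) : (n < k)%N -> qStirling n k = 0.
Proof.
elim: n k => [|n IHn] [|k] //= lt_nk.
by rewrite !IHn ?mulr0 ?addr0 // ltnW.
Qed.

End QAnalogues.

(* Permutations of {1, ..., N} are permutations of 'I_N = {0, ..., N - 1};
   displacements and inversions are unaffected by the shift. *)

Definition Vesztergombi (n k : nat) : {set 'S_(n + k)} :=
  [set s : 'S_(n + k) |
    [forall i : 'I_(n + k), - k%:Z <= (s i)%:Z - i%:Z <= n%:Z]].

Definition inv_perm (N : nat) (s : 'S_N) : nat :=
  #|[set p : 'I_N * 'I_N | (p.1 < p.2)%N && (s p.2 < s p.1)%N]|.

Definition pB (F : fieldType) (n k : nat) (q : F) : F :=
  \sum_(s in Vesztergombi n k) q ^+ inv_perm s.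

(* Main.v *)
(* Build the permutation row by row: choosing a column [x] among the set [C] of
   columns still free costs [q ^ #{y in C | y < x}], and these costs add up to
   the number of inversions. Only [B], the set of free columns among the first
   [n], matters for the remaining rows. Weighting [B] by [q] to the number of
   pairs (free column, used column to its right) makes the process depend on the
   number [m] of used columns alone: each of the first [k] rows acts by
     psi(m) |-> [m+1] (psi(m+1) + q^(n-m) psi(m)),
   and each of the last [n] rows by a similar two-term recurrence. Both are
   solved by a power of [q] times [m]_q! and a Stirling number at [1/q]. *)

Require Import Defs.
From mathcomp Require Import all_boot all_order all_fingroup all_algebra.
From mathcomp Require Import ring zify.
Import GRing.Theory.
Set Implicit Arguments.
Unset Strict Implicit.
Unset Printing Implicit Defensive.
Local Open Scope ring_scope.

(** * Filling a permutation row by row *)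

Section RowProcess.

Variables (F : fieldType) (q : F).

Lemma qintS (n : nat) : qint q n.+1 = qint q n + q ^+ n.
Proof. by rewrite /qint big_ord_recr. Qed.

(** Sorted by [f], the elements of [D] have ranks 0, ..., [#|D| - 1], each once. The induction
    removes the element with the largest value of [f], which enters no other rank. *)
Lemma sum_rank (T : finType) (f : T -> nat) (D : {set T}) :
  injective f ->
  \sum_(x in D) q ^+ #|[set y in D | (f y < f x)%N]| = qint q #|D|.
Proof.
move=> f_inj; move cD: #|D| => c.
elim: c D cD => [|c IHc] D cD.
  move/eqP: cD; rewrite cards_eq0 => /eqP ->.
  by rewrite big_set0 /qint big_ord0.
have /card_gt0P[z zD] : (0 < #|D|)%N by rewrite cD.
have [x0 x0D x0max] : exists2 x0, x0 \in D & forall y, y \in D -> (f y <= f x0)%N.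
  by case: (arg_maxnP f zD) => x0 x0D x0max; exists x0.
have cD0 : #|D :\ x0| = c by have := cardsD1 x0 D; rewrite cD x0D => -[].
rewrite (big_setD1 x0) //= qintS addrC -(IHc _ cD0); congr (_ + q ^+ _).
- apply: eq_bigr => x; rewrite !inE => /andP[_ xD].
  congr (q ^+ _); apply: eq_card => y; rewrite !inE.
  have [-> /=|//] := eqVneq y x0.
  by rewrite x0D ltnNge x0max.
- rewrite -[in RHS]cD0; apply: eq_card => y; rewrite !inE.
  have [-> /=|ny] := eqVneq y x0; first by rewrite ltnn andbF.
  case yD: (y \in D) => //=.
  by rewrite ltn_neqAle (inj_eq f_inj) ny x0max.
Qed.

Variable N : nat.
Implicit Types (C : {set 'I_N}) (x y : 'I_N).

Definition rank C x := #|[set y in C | (y < x)%N]|.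

(** [l] counts the rows left, [t] is the current row, [C] holds the columns still free, and [ok t x]
    allows column [x] in row [t]. *)
Fixpoint rowsum (ok : nat -> nat -> bool) (l t : nat) C : F :=
  if l is l'.+1 then
    \sum_(x in C | ok t x) q ^+ rank C x * rowsum ok l' t.+1 (C :\ x)
  else 1.

Definition inv_from (t : nat) (s : 'S_N) : nat :=
  #|[set p : 'I_N * 'I_N | [&& (t <= p.1)%N, (p.1 < p.2)%N & (s p.2 < s p.1)%N]]|.

(** Through [s], the inversions with left row [i] correspond to the smaller columns used by later
    rows, which are the free columns left of [s i] when row [i] is filled. *)
Lemma inv_fromS (i : 'I_N) (s : 'S_N) :
  inv_from i s =
  (rank (s @: [set j : 'I_N | (i <= j)%N]) (s i) + inv_from i.+1 s)%N.
Proof.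
rewrite /inv_from /rank -(cardsID [set p : 'I_N * 'I_N | p.1 == i]); congr (_ + _)%N.
- rewrite -[RHS](card_imset _ (@perm_inj _ s^-1)).
  have inj_pair : injective (fun j : 'I_N => (i, j)) by move=> a b [].
  rewrite -[RHS](card_imset _ inj_pair); apply: eq_card => -[a b].
  rewrite !inE /=; apply/idP/imsetP.
  + case/andP=> /and3P[_ ab sab] /eqP eai; exists b; last by rewrite eai.
    apply/imsetP; exists (s b); rewrite ?permK // !inE -eai sab andbT.
    by apply/imsetP; exists b => //; rewrite inE ltnW // -eai.
  + case=> j /imsetP[z]; rewrite !inE => /andP[/imsetP[w]].
    rewrite inE => iw -> sw ->; rewrite permK => -[-> ->].
    rewrite eqxx andbT leqnn sw /= andbT ltn_neqAle iw andbT.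
    by apply: contraTneq sw => /val_inj ->; rewrite ltnn.
- apply: eq_card => -[a b]; rewrite !inE /= [(i < a)%N]ltn_neqAle [i == a :> nat]eq_sym.
  by rewrite andbA.
Qed.

(* Composing [s0] with a transposition prescribes any admissible value on row [t]
   without changing the earlier rows. *)
Lemma sum_perm_extend (ok : nat -> nat -> bool) (l t : nat) (s0 : 'S_N) :
  (l + t)%N = N ->
  \sum_(s : 'S_N | [forall i : 'I_N, if (i < t)%N then s i == s0 i else ok i (s i)])
     q ^+ inv_from t s
  = rowsum ok l t (s0 @: [set j : 'I_N | (t <= j)%N]).
Proof.
elim: l t s0 => [|l IHl] t s0 ltN /=.
  have ilt (i : 'I_N) : (i < t)%N by rewrite -[t]add0n ltN.
  rewrite (big_pred1 s0) => [|s].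
    rewrite /inv_from; set A := [set p | _].
    suff -> : A = set0 by rewrite cards0.
    by apply/setP => -[a b]; rewrite !inE /= leqNgt ilt.
  apply/forallP/eqP => [h|-> i]; last by rewrite ilt.
  by apply/permP => i; have := h i; rewrite ilt => /eqP.
have tN : (t < N)%N by rewrite -ltN addSn ltnS leq_addl.
pose i := Ordinal tN; set C := s0 @: _.
(* Sort the permutations by their value on row [t]; [C] consists of the columns that [s0] does not
   use before row [t]. *)
rewrite (partition_big (fun s : 'S_N => s i) (fun x => (x \in C) && ok t x)) /=; last first.
  move=> s /forallP h; apply/andP; split; last by have := h i; rewrite ltnn.
  have [j jE] : exists j, s i = s0 j by exists ((s0^-1)%g (s i)); rewrite permKV.
  rewrite jE imset_f // inE leqNgt; apply/negP => jt.
  have := h j; rewrite jt -jE => /eqP/perm_inj ji.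
  by rewrite ji ltnn in jt.
apply: eq_bigr => x /andP[xC okx].
pose s1 : 'S_N := (s0 * tperm (s0 i) x)%g.
have s1i : s1 i = x by rewrite permM tpermL.
have s1lt (j : 'I_N) : (j < t)%N -> s1 j = s0 j.
  move=> jt; rewrite permM tpermD //.
    by apply: contraTneq jt => /perm_inj <-; rewrite ltnn.
  case/imsetP: xC => z; rewrite inE => tz ->.
  by apply: contraTneq jt => /perm_inj <-; rewrite -leqNgt.
have imE (s : 'S_N) : (forall j : 'I_N, (j < t)%N -> s j = s0 j) ->
    s @: [set j : 'I_N | (t <= j)%N] = C.
  move=> es; apply/eqP; rewrite eqEcard !card_imset ?leqnn ?andbT; try exact: perm_inj.
  apply/subsetP => _ /imsetP[j jt ->]; rewrite -(permKV s0 (s j)) imset_f //.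
  rewrite inE leqNgt; apply/negP => lt1; have := es _ lt1; rewrite permKV => /perm_inj e.
  by move: lt1 jt; rewrite e inE ltnNge => /negP.
have imD : s1 @: [set j : 'I_N | (t < j)%N] = C :\ x.
  rewrite -(imE s1) //; apply/setP => y; rewrite !inE; apply/imsetP/andP.
    case=> j; rewrite inE => tj ->; rewrite -s1i (inj_eq perm_inj); split.
      by rewrite -val_eqE /= gtn_eqF.
    by rewrite imset_f // inE ltnW.
  case=> yx /imsetP[j]; rewrite inE => tj yE; exists j => //; rewrite inE ltn_neqAle tj andbT.
  apply: contraNneq yx => tj'; rewrite yE -s1i; apply/eqP; congr (s1 _).
  by apply/val_inj.
rewrite -imD -IHl ?addnS // big_distrr /=.
have allE (s : 'S_N) :
    [forall j : 'I_N, if (j < t)%N then s j == s0 j else ok j (s j)] && (s i == x)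
    = [forall j : 'I_N, if (j < t.+1)%N then s j == s1 j else ok j (s j)].
  apply/andP/forallP => [[/forallP h /eqP six] j|h].
    rewrite ltnS leq_eqVlt; have [jt|jt /=] := eqVneq (j : nat) t.
      by rewrite /= (_ : j = i) ?six ?s1i //; apply: val_inj.
    by have := h j; case: ifP => // jlt; rewrite s1lt.
  have six : s i = x by have := h i; rewrite ltnSn s1i => /eqP.
  split; last by rewrite six.
  apply/forallP => j; have := h j; rewrite ltnS leq_eqVlt.
  have [jt _|jt /=] := eqVneq (j : nat) t.
    by rewrite jt ltnn (_ : j = i) ?six //; apply: val_inj.
  by case: ifP => // jlt; rewrite s1lt.
apply: eq_big => [s|s]; first exact: allE.
move=> /andP[/forallP h /eqP six].
rewrite (inv_fromS i) exprD six imE // => j jt.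
by have := h j; rewrite jt => /eqP.
Qed.

Lemma sum_perm_rowsum (ok : nat -> nat -> bool) :
  \sum_(s : 'S_N | [forall i : 'I_N, ok i (s i)]) q ^+ inv_perm s
  = rowsum ok N 0 setT.
Proof.
have := @sum_perm_extend ok N 0 1%g (addn0 N).
rewrite (_ : _ @: _ = setT) => [<-|]; first by [].
by apply/setP => x; rewrite inE; apply/imsetP; exists x; rewrite ?inE ?perm1.
Qed.

End RowProcess.

(** * Weighted sums over sets of free columns *)

Section WeightedSums.

Variables (F : fieldType) (q : F) (N : nat).
Implicit Types (B C Om : {set 'I_N}) (x y : 'I_N).

Definition cols (a b : nat) : {set 'I_N} := [set x : 'I_N | (a <= x < b)%N].

Lemma card_cols (a b : nat) : (b <= N)%N -> #|cols a b| = (b - a)%N.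
Proof.
have card0 c : (c <= N)%N -> #|cols 0 c| = c.
  move=> cN; rewrite /cols -sum1dep_card /=.
  by rewrite -(big_ord_widen N (fun=> 1%N) cN) sum1_card card_ord.
move=> bN; have [ab|ba] := leqP a b; last first.
  apply/eqP; rewrite (eqP (ltnW ba)) cards_eq0; apply/eqP/setP => x; rewrite !inE.
  by apply/negP => /andP[ax xb]; have := leq_trans ba (leq_trans ax (ltnW xb)); rewrite ltnn.
have := card0 b bN; rewrite -(cardsID (cols 0 a)).
have -> : cols 0 b :&: cols 0 a = cols 0 a.
  apply/setP => x; rewrite !inE /= andb_idl // => xa; exact: leq_trans xa ab.
have -> : cols 0 b :\: cols 0 a = cols a b.
  by apply/setP => x; rewrite !inE /= -leqNgt.
by rewrite (card0 a (leq_trans ab bN)) => /(canRL (addKn a)).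
Qed.

Definition cross Om B : nat := (\sum_(y in B) #|[set x in Om :\: B | (y < x)%N]|)%N.

(** Freeing [x] destroys the pairs formed by a column of [B] and [x] to its right, [rank B x] in
    number, and creates those formed by [x] and a used column to its right. *)
Lemma cross_setU1 Om B x : x \in Om :\: B ->
  (cross Om (x |: B) + rank B x =
   cross Om B + #|[set z in Om :\: B | (x < z)%N]|)%N.
Proof.
move=> xOB; have [xNB xO] : x \notin B /\ x \in Om by move: xOB; rewrite inE => /andP[].
rewrite /cross big_setU1 //= -addnA [RHS]addnC; congr (_ + _)%N.
  by apply: eq_card => z; rewrite !inE; have [->|] := eqVneq z x; rewrite ?ltnn ?andbF.
have -> : rank B x = (\sum_(y in B) (y < x))%N.
  by rewrite /rank -sum1dep_card big_mkcondr; apply: eq_bigr => y _; case: ifP.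
rewrite -big_split /=; apply: eq_bigr => y yB.
rewrite addnC [RHS](cardsD1 x) inE xOB; congr (_ + _)%N.
by apply: eq_card => z; rewrite !inE negb_or !andbA.
Qed.

(* The weight of [B] counts the inversions between the columns of [Om] used by
   the rows already treated and those, forming [B], that are still free. *)
Definition wsum Om (m : nat) (g : {set 'I_N} -> F) : F :=
  \sum_(B : {set 'I_N} | (B \subset Om) && (#|B| + m == #|Om|)%N)
     q ^+ cross Om B * g B.

(** Reindex by the set left after the removal. By [cross_setU1] the cost of [x] becomes [q] to the
    number of used columns right of [x]; summed over the [m + 1] used columns this is a q-integer
    that no longer depends on the set. *)
Lemma wsum_remove Om (m : nat) (g : {set 'I_N} -> F) :
  wsum Om m (fun B => \sum_(x in B) q ^+ rank B x * g (B :\ x)) =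
  qint q m.+1 * wsum Om m.+1 g.
Proof.
pose E B := \sum_(x in Om :\: B)
  q ^+ #|[set z in Om :\: B | (x < z)%N]| * (q ^+ cross Om B * g B).
transitivity (\sum_(B : {set 'I_N} | (B \subset Om) && (#|B| + m.+1 == #|Om|)%N) E B); last first.
  rewrite /wsum big_distrr /=; apply: eq_bigr => B /andP[sB /eqP cB].
  rewrite /E -big_distrl /=; congr (_ * _).
  have -> : m.+1 = #|Om :\: B| by rewrite cardsD (setIidPr sB) -cB addKn.
  (* [sum_rank] counts smaller values, so [N - x] reverses the order. *)
  rewrite -(@sum_rank _ q _ (fun x => (N - x)%N)); last first.
    by move=> x y /= e; apply: val_inj => /=; have := ltn_ord x; have := ltn_ord y; lia.
  apply: eq_bigr => x _; congr (q ^+ _); apply: eq_card => y; rewrite !inE.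
  by congr (_ && _); have := ltn_ord x; have := ltn_ord y; lia.
rewrite /wsum /E.
under eq_bigr => B _ do rewrite big_distrr /=.
rewrite !pair_big_dep /=.
rewrite (reindex_onto (fun p : {set 'I_N} * 'I_N => (p.2 |: p.1, p.2))
                      (fun p => (p.1 :\ p.2, p.2))) /=; last first.
  by case=> B x /= /andP[_ xB]; rewrite setD1K.
apply: eq_big => [[B x]|[B x]] /=.
  rewrite xpair_eqE eqxx andbT setU11 andbT subUset sub1set !inE.
  have [xB|xNB] /= := boolP (x \in B).
    rewrite andbF; apply/negP => /andP[_ /eqP e].
    by move: xB; rewrite -e !inE eqxx.
  rewrite setU1K // eqxx andbT cardsU1 xNB addnS add1n addSn.
  by case: (x \in Om) => /=; rewrite ?andbF ?andbT.
rewrite setU11 andbT => /andP[/andP[sB _] /eqP[e]].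
have xNB : x \notin B by rewrite -e !inE eqxx.
have xOB : x \in Om :\: B.
  by rewrite inE xNB (subsetP sB) // setU11.
rewrite e !mulrA -!exprD; congr (q ^+ _ * _).
rewrite [RHS]addnC -cross_setU1 //; congr (_ + _)%N.
by apply: eq_card => y; rewrite !inE; have [->|] := eqVneq y x; rewrite ?ltnn ?andbF.
Qed.

(** If [i] is free, it lies left of all [m] used columns and contributes [q ^+ m]; if it is used, no
    free column lies to its left, and [m - 1] used columns remain in [Om]. *)
Lemma wsum_setU1_min Om (m : nat) (g : {set 'I_N} -> F) (i : 'I_N) :
  (forall x, x \in Om -> (i < x)%N) ->
  wsum (i |: Om) m g =
  q ^+ m * wsum Om m (fun B => g (i |: B)) +
  (if m is m'.+1 then wsum Om m' g else 0).
Proof.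
move=> iOm; have iNO : i \notin Om by apply/negP => /iOm; rewrite ltnn.
have iNB (B : {set 'I_N}) : B \subset Om -> i \notin B by move/subsetP => sB; apply: contra iNO => /sB.
rewrite {1}/wsum (bigID (fun B : {set 'I_N} => i \in B)) /=; congr (_ + _).
- rewrite /wsum big_distrr /= (reindex_onto (fun B => i |: B) (fun B => B :\ i)) /=; last first.
    by move=> B /andP[_ iB]; rewrite setD1K.
  apply: eq_big => [B|B].
    rewrite setU11 andbT; have [iB|iNB'] := boolP (i \in B).
      rewrite [in RHS](_ : B \subset Om = false); last by apply/negP => /iNB; rewrite iB.
      apply/negP => /andP[_ /eqP e]; by move: iB; rewrite -e !inE eqxx.
    rewrite setU1K // eqxx andbT !cardsU1 iNO iNB' !add1n addSn eqSS.
    rewrite subUset sub1set setU11 /=; congr (_ && _).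
    apply/subsetP/subsetP => sB x xB; last by rewrite inE sB ?orbT.
    by have := sB x xB; rewrite !inE; case: eqP xB iNB' => [-> ->|].
  rewrite setU11 andbT => /andP[/andP[sB cB] /eqP e].
  have iB : i \notin B by rewrite -e !inE eqxx.
  have sB' : B \subset Om.
    apply/subsetP => x xB; have := subsetP sB x; rewrite !inE xB orbT => /(_ isT).
    by case: eqP xB iB => [-> ->|].
  rewrite mulrA -exprD; congr (q ^+ _ * _).
  move: cB; rewrite !cardsU1 iNO iB !add1n addSn eqSS => /eqP cB.
  rewrite /cross big_setU1 //=; congr (_ + _)%N.
    have -> : m = #|Om :\: B| by rewrite cardsD (setIidPr sB') -cB addKn.
    apply: eq_card => z; rewrite !inE.
    have [->|] /= := eqVneq z i; first by rewrite (negPf iNO) andbF.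
    by case zO: (z \in Om); rewrite ?andbF //= iOm ?andbT.
  apply: eq_bigr => y yB; apply: eq_card => z; rewrite !inE.
  by have [->|] /= := eqVneq z i; rewrite ?(negPf iNO) ?andbF.
- have PE (B : {set 'I_N}) : ((B \subset i |: Om) && (#|B| + m == #|i |: Om|)%N) && (i \notin B)
      = (B \subset Om) && (#|B| + m == #|Om|.+1)%N.
    rewrite cardsU1 iNO add1n andbAC; congr (_ && _).
    apply/andP/idP => [[/subsetP sB iB]|sB].
      apply/subsetP => x xB; have := sB x xB; rewrite !inE.
      by case: eqP xB iB => [-> ->|].
    by split; [apply: subset_trans sB (subsetUr _ _) | apply: iNB].
  rewrite (eq_bigl _ _ PE); case: m {PE} => [|m].
    apply: big1 => B /andP[sB]; rewrite addn0 => /eqP e.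
    by have := subset_leq_card sB; rewrite e ltnn.
  apply: eq_big => [B|B /andP[sB _]]; first by rewrite addnS eqSS.
  congr (q ^+ _ * _); apply: eq_bigr => y yB; apply: eq_card => z; rewrite !inE.
  have [->|] //= := eqVneq z i; rewrite (negPf iNO) !andbF /=.
  have yO := subsetP sB _ yB; rewrite (leq_gtF (ltnW (iOm y yO))) andbF //.
Qed.

(** A column below [n] has the same rank in [C] as in [B]. A column from [n] on leaves [B] unchanged
    and has all of [B] to its left, so its rank is [#|B|] plus its rank in [C :&: cols n u], and
    [sum_rank] applies. *)
Lemma rowsum_step C (n u : nat) (f g : {set 'I_N} -> F) :
  (n <= u)%N ->
  (forall x, x \in C -> (x < u)%N -> f (C :\ x) = g ((C :\ x) :&: cols 0 n)) ->
  \sum_(x in C | (x < u)%N) q ^+ rank C x * f (C :\ x) =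
  let B := C :&: cols 0 n in
  \sum_(x in B) q ^+ rank B x * g (B :\ x) +
  q ^+ #|B| * qint q #|C :&: cols n u| * g B.
Proof.
move=> nu fg /=; set B := C :&: cols 0 n; set D := C :&: cols n u.
rewrite (bigID (fun x : 'I_N => (x < n)%N)) /=; congr (_ + _).
  apply: eq_big => [x|x /andP[/andP[xC xu] xn]].
    rewrite !inE -andbA; congr (_ && _); apply: andb_idl => /= xn; exact: leq_trans xn nu.
  rewrite fg //; congr (q ^+ _ * g _).
    apply: eq_card => y; rewrite !inE /=; case: (y \in C) => //=.
    by rewrite andb_idl // => yx; apply: ltn_trans yx xn.
  by apply/setP => y; rewrite !inE -!andbA.
rewrite -(@sum_rank _ q _ (fun x : 'I_N => x : nat)); last exact: val_inj.
rewrite -mulrA big_distrl big_distrr /=.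
apply: eq_big => [x|x /andP[/andP[xC xu] xn]].
  by rewrite !inE -andbA -leqNgt; congr (_ && _); rewrite andbC.
rewrite mulrA -exprD fg //; congr (q ^+ _ * g _).
  rewrite /rank -(cardsID (cols 0 n)); congr (_ + _)%N; apply: eq_card => y; rewrite !inE /=.
    case: (y \in C) => //=; rewrite andb_idl // => yn.
    by apply: leq_trans yn _; rewrite leqNgt.
  rewrite -leqNgt; case yx: (y < x)%N; rewrite ?andbF ?andbT //.
  by rewrite (ltn_trans yx xu) andbT andbC.
apply/setP => y; rewrite !inE; have [->|] //= := eqVneq y x.
by rewrite (negPf xn) andbF.
Qed.

End WeightedSums.

(** * Solving the two recurrences *)

Section ClosedForms.

Variables (F : fieldType) (q : F).
Hypothesis hq : q != 0.

Lemma qfactS (m : nat) : qfact q m.+1 = qfact q m * qint q m.+1.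
Proof. by rewrite /qfact big_nat_recr. Qed.

Lemma qint_inv (m : nat) : qint q^-1 m.+1 = qint q m.+1 / q ^+ m.
Proof.
rewrite /qint (reindex_inj rev_ord_inj) /= big_distrl /=.
apply: eq_bigr => i _; have im : (i <= m)%N by rewrite -ltnS.
have -> : q ^+ m = q ^+ (m - i) * q ^+ i by rewrite -exprD subnK.
rewrite subSS exprVn invfM mulrCA mulfV ?mulr1 //.
exact: expf_neq0.
Qed.

Lemma qint1 : qint q 1 = 1.
Proof. by rewrite /qint big_ord1. Qed.

Lemma qStirlingS0 (p : F) (n : nat) : qStirling p n.+1 0 = 0.
Proof. by rewrite /= /qint big_ord0 mul0r. Qed.

Lemma qStirlingS_inv (n k : nat) :
  qStirling q^-1 n.+1 k.+1 =
  (qStirling q^-1 n k + qint q k.+1 * qStirling q^-1 n k.+1) / q ^+ k.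
Proof. by rewrite /= qint_inv exprVn mulrDl mulrC [in RHS]mulrAC. Qed.

(** Closed form of the weighted sum when [l] rows remain and [m] of the last [l] among the first [n]
    columns are used. *)
Definition bottom (l m : nat) : F :=
  qfact q m * q ^+ (m * l) / q ^+ 'C(m, 2) * qStirling q^-1 l.+1 m.+1.

Lemma bottom0 (m : nat) : bottom 0 m = (m == 0%N)%:R.
Proof.
rewrite /bottom; case: m => [|m]; last by rewrite qStirling_gt // mulr0.
rewrite qStirlingS_inv /qfact big_geq //= mulr0 addr0 !expr0.
by rewrite !divr1 !mulr1.
Qed.

Lemma bottomS0 (l : nat) : bottom l.+1 0 = bottom l 0.
Proof.
rewrite /bottom !mul0n (qStirlingS_inv l.+1) qStirlingS0.
by rewrite qint1 add0r mul1r !expr0 !divr1.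
Qed.

Lemma bottomSS (l m : nat) :
  bottom l.+1 m.+1 =
  qint q m.+2 * bottom l m.+1 + q ^+ l / q ^+ m * qint q m.+1 * bottom l m.
Proof.
rewrite /bottom (qStirlingS_inv l.+1) qfactS binS bin1.
rewrite !mulSn !mulnS !exprD !exprS.
have := expf_neq0 m hq; have := expf_neq0 l hq; have := expf_neq0 'C(m, 2) hq.
move: (q ^+ m) (q ^+ l) (q ^+ (m * l)) (q ^+ 'C(m, 2)) => a b c d nd nb na.
field.
by rewrite hq na nd.
Qed.

Variable n : nat.

(** Coefficient of [top j m] in [top (j + k) 0]: the total factor collected while the number of used
    columns goes from 0 to [m] in [k] rows. *)
Definition topcoef (k m : nat) : F :=
  qfact q m * q ^+ (n * k + 'C(m.+1, 2)) / q ^+ (m * n) * qStirling q^-1 k.+1 m.+1.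

Lemma topcoefS0 (k : nat) : topcoef k.+1 0 = q ^+ n * topcoef k 0.
Proof.
rewrite /topcoef !mul0n (qStirlingS_inv k.+1) qStirlingS0 qint1 mulnS.
by rewrite !expr0 !addn0 exprD add0r mul1r !divr1; ring.
Qed.

Lemma topcoefSS (k m : nat) :
  topcoef k.+1 m.+1 =
  qint q m.+1 * topcoef k m +
  q ^+ n / q ^+ m.+1 * qint q m.+2 * topcoef k m.+1.
Proof.
rewrite /topcoef (qStirlingS_inv k.+1) qfactS [in 'C(m.+2, 2)]binS bin1.
rewrite !mulSn !mulnS !exprD !exprS.
have := expf_neq0 m hq; have := expf_neq0 n hq; have := expf_neq0 (m * n) hq.
move: (q ^+ m) (q ^+ n) (q ^+ (m * n)) (q ^+ 'C(m.+1, 2)) (q ^+ (n * k)).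
move=> a b c d e nc nb na.
field.
by rewrite hq na nb nc.
Qed.

Lemma topcoef_gt (k m : nat) : (k < m)%N -> topcoef k m = 0.
Proof. by move=> km; rewrite /topcoef qStirling_gt ?mulr0. Qed.

(** The weighted sum when [j] of the first [k] rows remain. Writing [q ^+ n / q ^+ m] avoids a
    truncated exponent [n - m] for [m > n]. *)
Fixpoint top (j m : nat) : F :=
  if j is j'.+1 then
    qint q m.+1 * (top j' m.+1 + q ^+ n / q ^+ m * top j' m)
  else bottom n m.

(** The recurrence of [topcoef] is the transpose of that of [top]: a row moves [m] to [m + 1] or
    stays at [m], and the two sums are matched move by move. *)
Lemma sum_topcoef (k j : nat) :
  \sum_(m < k.+1) topcoef k m * top j m = top (j + k) 0.
Proof.
elim: k j => [|k IHk] j.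
  rewrite big_ord1 addn0 /topcoef muln0 mul0n /= /qfact big_geq //.
  by rewrite !expr0 mulr0 addr0 !mul1r invr1 !mul1r.
rewrite addnS -addSn -IHk big_ord_recl topcoefS0.
under eq_bigr => m _ do rewrite /= topcoefSS mulrDl.
rewrite big_split /= addrCA /=.
under [in RHS]eq_bigr => m _ do rewrite mulrCA mulrDr mulrDr [topcoef k m * _]mulrC.
rewrite big_split /=; congr (_ + _).
  by apply: eq_bigr => m _; ring.
(* For the rows that stay at [m], the term [m = 0] rejoins the sum, and the extra index [k + 1]
   contributes 0. *)
transitivity (\sum_(m < k.+2)
    q ^+ n / q ^+ m * qint q m.+1 * topcoef k m * top j m).
  by rewrite [RHS]big_ord_recl /= expr0 divr1 qint1 mulr1.
rewrite big_ord_recr /= topcoef_gt // mulr0 mul0r addr0.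
by apply: eq_bigr => m _; ring.
Qed.

End ClosedForms.

(** * The first [k] rows and the last [n] rows *)

Definition admissible (n k t x : nat) : bool :=
  (x <= t + n)%N && (t <= x + k)%N.

Section Phases.

Variables (F : fieldType) (q : F) (n k : nat).
Hypothesis hq : q != 0.

Local Notation N := (n + k)%N.
Implicit Types (B C Om : {set 'I_N}) (x y : 'I_N).

Local Notation ok := (admissible n k).

Lemma expr_card (T : finType) (A : {set T}) (m l : nat) :
  (#|A| + m)%N = l -> q ^+ #|A| = q ^+ l / q ^+ m.
Proof. by move=> <-; rewrite exprD mulfK ?expf_neq0. Qed.

Lemma wsumD Om (m : nat) (g1 g2 : {set 'I_N} -> F) :
  wsum q Om m (fun B => g1 B + g2 B) = wsum q Om m g1 + wsum q Om m g2.
Proof. by rewrite /wsum -big_split; apply: eq_bigr => B _; rewrite mulrDr. Qed.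

Lemma eq_wsum Om (m : nat) (g1 g2 : {set 'I_N} -> F) :
  (forall B, B \subset Om -> (#|B| + m)%N = #|Om| -> g1 B = g2 B) ->
  wsum q Om m g1 = wsum q Om m g2.
Proof. by move=> g12; apply: eq_bigr => B /andP[sB /eqP cB]; rewrite g12. Qed.

Lemma wsumZ Om (m : nat) (c : F) (g : {set 'I_N} -> F) :
  wsum q Om m (fun B => c * g B) = c * wsum q Om m g.
Proof. by rewrite /wsum big_distrr; apply: eq_bigr => B _; rewrite mulrCA. Qed.

(** There are as many rows left as free columns, so [x] would have to be used, but it is closed to
    row [t] and to all later ones. *)
Lemma rowsum_dead (l t : nat) C x :
  #|C| = l -> x \in C -> (x + k < t)%N -> rowsum q ok l t C = 0.
Proof.
elim: l t C => [|l IHl] t C cC xC xt.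
  by move/eqP: cC; rewrite cards_eq0 => /eqP C0; rewrite C0 inE in xC.
rewrite /=; apply: big1 => y /andP[yC /andP[_ ty]].
rewrite IHl ?mulr0 ?leqW //; first by have := cardsD1 y C; rewrite yC cC => -[].
by rewrite !inE xC andbT; apply: contraTneq ty => <-; rewrite -ltnNge.
Qed.

(* A column [j < n] is closed to the rows after [k + j], so it must be chosen by
   row [k + j] if it is still free then. *)
Lemma rowsum_bottom (l i : nat) : (l + i)%N = n ->
  exists g : {set 'I_N} -> F,
    (forall C, #|C| = l -> (forall x, x \in C -> (i <= x)%N) ->
       rowsum q ok l (k + i) C = g (C :&: cols N 0 n)) /\
    (forall m, wsum q (cols N i n) m g = bottom q l m).
Proof.
elim: l i => [|l IHl] i lin.
  exists (fun=> 1); split=> // m.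
  have -> : cols N i n = set0.
    by apply/setP => x; rewrite !inE; apply/negP; lia.
  rewrite /wsum (eq_bigl (fun B => (B == set0) && (m == 0%N))); last first.
    move=> B; rewrite subset0 cards0; case: eqP => // ->.
    by rewrite cards0.
  rewrite bottom0 //; case: m => [|m] /=.
    rewrite (big_pred1 set0) => [|B]; last by rewrite andbT.
    by rewrite /cross big_set0 expr0 mulr1.
  by rewrite big_pred0 // => B; rewrite andbF.
have [g [gW gS]] := IHl i.+1 (etrans (addnS _ _) lin).
have iN : (i < N)%N by lia.
have in' : (i < n)%N by lia.
pose i0 : 'I_N := Ordinal iN.
(* [h1] takes a column below [n]; [h2] takes one of the [l + 1 - #|B|] free columns from [n] on. *)
pose h1 B := \sum_(x in B) q ^+ rank B x * g (B :\ x).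
pose h2 B := q ^+ #|B| * qint q (l.+1 - #|B|) * g B.
(* When column [i] is free it is forced, and as the leftmost free column it costs nothing. *)
exists (fun B => if i0 \in B then g (B :\ i0) else h1 B + h2 B); split.
  move=> C cC leC; rewrite [LHS]/=.
  have cCD x : x \in C -> #|C :\ x| = l.
    by move=> xC; have := cardsD1 x C; rewrite xC cC => -[].
  have okE x : x \in C -> ok (k + i) x.
    by move=> xC; have := leC x xC; have := ltn_ord x; rewrite /admissible; lia.
  have C0 : (i0 \in C :&: cols N 0 n) = (i0 \in C) by rewrite !inE /= in' andbT.
  rewrite C0 -addnS; case: ifP => i0C.
    rewrite (bigD1 i0) /=; last by rewrite i0C; apply: (okE i0).
    rewrite big1 => [|x /andP[/andP[xC _] xi]]; last first.
      rewrite (@rowsum_dead _ _ _ i0) ?mulr0 ?cCD // ?inE ?i0C ?andbT 1?eq_sym //=.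
      by rewrite addnS ltnS addnC.
    rewrite addr0 gW ?cCD //; last first.
      move=> x; rewrite !inE => /andP[xi xC]; rewrite ltn_neqAle leC // andbT.
      by rewrite eq_sym.
    have -> : rank C i0 = 0%N.
      apply/eqP; rewrite cards_eq0; apply/eqP/setP => y; rewrite !inE.
      by apply/negP => /andP[/leC]; rewrite leqNgt => /negP.
    by rewrite expr0 mul1r; congr g; apply/setP => y; rewrite !inE -!andbA.
  transitivity (\sum_(x in C | (x < N)%N)
      q ^+ rank C x * rowsum q ok l (k + i.+1) (C :\ x)).
    by apply: eq_bigl => x; rewrite ltn_ord; case xC: (x \in C) => //=; rewrite okE.
  rewrite (@rowsum_step _ _ _ _ n N _ g) ?leq_addr //; last first.
    move=> x xC _; rewrite gW ?cCD // => y; rewrite !inE => /andP[_ yC].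
    rewrite ltn_neqAle leC // andbT; apply: contraFneq i0C => iy.
    by rewrite (_ : i0 = y) //; apply: val_inj.
  rewrite /= /h2; congr (_ + _ * qint q _ * _).
  rewrite -cC -(cardsID (cols N 0 n) C) addKn.
  by apply: eq_card => y; rewrite !inE ltn_ord andbT /= -leqNgt andbC.
have intE : cols N i n = i0 |: cols N i.+1 n.
  apply/setP => x; rewrite !inE leq_eqVlt andb_orl.
  have -> : (i == x :> nat) = (x == i0) by rewrite eq_sym.
  by have [->|] //= := eqVneq x i0; rewrite in'.
have i0min x : x \in cols N i.+1 n -> (i0 < x)%N by rewrite inE => /andP[].
have i0B B : B \subset cols N i.+1 n -> i0 \notin B.
  by move/subsetP => sB; apply/negP => /sB/i0min; rewrite ltnn.
have cint : #|cols N i.+1 n| = l by rewrite card_cols ?leq_addr //; lia.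
move=> m; rewrite intE wsum_setU1_min //.
rewrite [X in q ^+ m * X](@eq_wsum _ _ _ g); last first.
  by move=> B sB _; rewrite setU11 setU1K ?i0B.
rewrite gS; case: m => [|m]; first by rewrite expr0 mul1r addr0 bottomS0.
rewrite (@eq_wsum _ _ _ (fun B => h1 B + q ^+ l / q ^+ m * qint q m.+1 * g B)); last first.
  move=> B sB cB; rewrite (negPf (i0B _ sB)) /h2 -(expr_card (etrans cB cint)).
  by congr (_ + _ * qint q _ * _); rewrite -cint -cB; lia.
(* The factor [q ^+ m.+1] of the forced choice and [qint q m.+1] from [h1] add up to
   [qint q m.+2]. *)
by rewrite wsumD wsumZ wsum_remove !gS bottomSS // [qint q m.+2]qintS; ring.
Qed.

(* Row [t] opens the column [n + t], so the number of open free columns beyond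
   the first [n] exceeds by one the number of used columns among the first [n]. *)
Lemma rowsum_top (j t : nat) : (j + t)%N = k ->
  exists g : {set 'I_N} -> F,
    (forall C, #|C| = (n + j)%N -> (forall x, (n + t <= x)%N -> x \in C) ->
       rowsum q ok (n + j) t C = g (C :&: cols N 0 n)) /\
    (forall m, wsum q (cols N 0 n) m g = top q n j m).
Proof.
elim: j t => [|j IHj] t jtk.
  have [g [gW gS]] := rowsum_bottom (addn0 n); exists g; split=> // C cC _.
  have -> : t = (k + 0)%N by rewrite -jtk addn0.
  by rewrite addn0 gW // cC addn0.
have [g [gW gS]] := IHj t.+1 (etrans (addnS _ _) jtk).
pose h1 B := \sum_(x in B) q ^+ rank B x * g (B :\ x).
pose h2 B := q ^+ #|B| * qint q (n.+1 - #|B|) * g B.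
exists (fun B => h1 B + h2 B); split.
  move=> C cC geC; rewrite addnS /=.
  (* Since [t < k], only the upper bound on [x] restricts row [t]. *)
  transitivity (\sum_(x in C | (x < (n + t).+1)%N)
      q ^+ rank C x * rowsum q ok (n + j) t.+1 (C :\ x)).
    apply: eq_bigl => x; congr (_ && _); by rewrite /admissible; lia.
  rewrite (@rowsum_step _ _ _ _ n _ _ g); first last.
  - move=> x xC xt; rewrite gW //.
      by have := cardsD1 x C; rewrite xC cC addnS => -[].
    move=> y ty; rewrite !inE geC ?andbT; last by lia.
    by apply: contraTneq ty => ->; rewrite -ltnNge addnS.
  - by rewrite leqW ?leq_addr.
  rewrite /= /h2; congr (_ + _ * qint q _ * _).
  (* [C] splits into its part below [n], its columns from [n] to [n + t], and all [j] columns
     beyond; hence the middle part has [n + 1] minus the size of the first. *)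
  have e1 := cardsID (cols N 0 n) C.
  have e2 := cardsID (cols N n (n + t).+1) (C :\: cols N 0 n).
  have e3 : (C :\: cols N 0 n) :&: cols N n (n + t).+1 =
            C :&: cols N n (n + t).+1.
    apply/setP => y; rewrite !inE /= -leqNgt.
    by case: (leqP n y) => //=; rewrite andbF.
  have e4 : (C :\: cols N 0 n) :\: cols N n (n + t).+1 =
            cols N (n + t).+1 N.
    apply/setP => y; rewrite !inE /= ltn_ord andbT.
    by have := geC y; case: (y \in C) => gy; lia.
  have e5 := @card_cols N (n + t).+1 N (leqnn _).
  move: e1 e2; rewrite e3 e4 e5 cC.
  by move: #|_| #|_| #|_| => a b c; lia.
move=> m; rewrite (@eq_wsum _ _ _ (fun B => h1 B + q ^+ n / q ^+ m * qint q m.+1 * g B)).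
  by rewrite wsumD wsumZ wsum_remove !gS /=; ring.
have cint : #|cols N 0 n| = n by rewrite card_cols ?leq_addr // subn0.
move=> B sB cB; rewrite /h2 -(expr_card (etrans cB cint)).
by congr (_ + _ * qint q _ * _); move: (etrans cB cint); move: #|_| => b; lia.
Qed.

Lemma rowsum_all : rowsum q ok N 0 [set: 'I_N] = top q n k 0.
Proof.
have [g [gW gS]] := rowsum_top (addn0 k).
have -> : rowsum q ok N 0 [set: 'I_N] = g (cols N 0 n).
  by rewrite gW ?setTI ?cardsT ?card_ord // => x; rewrite inE.
rewrite -gS /wsum.
(* With no used column, the only set is the full one, whose weight is 1. *)
rewrite (big_pred1 (cols N 0 n)) => [|B].
  rewrite /cross big1 ?expr0 ?mul1r // => y _; apply/eqP.
  by rewrite cards_eq0; apply/eqP/setP => z; rewrite !inE andNb.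
rewrite addn0 /= eqEcard; apply: andb_id2l => sB.
by rewrite eqn_leq (subset_leq_card sB).
Qed.

End Phases.

(** * The closed formula *)

Theorem theorem7 (F : fieldType) (q : F) (hq : q != 0) (n k : nat) :
  pB n k q =
  q ^+ (n * k) *
  \sum_(m < (minn n k).+1)
     qStirling q^-1 n.+1 m.+1 * qStirling q^-1 k.+1 m.+1 *
     qfact q m ^+ 2 * q ^+ m.
Proof.
transitivity (top q n k 0).
  rewrite -rowsum_all // -sum_perm_rowsum /pB; apply: eq_bigl => s; rewrite inE.
  apply: eq_forallb => i; rewrite /admissible.
  by move: (nat_of_ord (s i)) (nat_of_ord i) => a b; lia.
rewrite -[k in top _ _ k]add0n -sum_topcoef // big_distrr /=.
have mk : ((minn n k).+1 <= k.+1)%N by rewrite ltnS geq_minr.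
rewrite [RHS](big_ord_widen k.+1 (fun m => q ^+ (n * k) *
  (qStirling q^-1 n.+1 m.+1 * qStirling q^-1 k.+1 m.+1 * qfact q m ^+ 2 * q ^+ m))) //.
rewrite [RHS]big_mkcond; apply: eq_bigr => m _; case: ifPn => mn.
  (* The powers [q ^+ (m * n)] cancel, and the difference of the two binomial exponents leaves
     [q ^+ m]. *)
  rewrite /topcoef /bottom binS bin1 !exprD.
  have := expf_neq0 (m * n) hq; have := expf_neq0 'C(m, 2) hq.
  move: (q ^+ (m * n)) (q ^+ 'C(m, 2)) => a b nb na.
  by field; rewrite na nb.
(* For [m > n] the Stirling factor in [bottom n m] vanishes, which cuts the sum at [minn n k]. *)
rewrite /bottom (@qStirling_gt _ _ n.+1) ?mulr0 // ltnS.
by have := ltn_ord m; lia.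
Qed.
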